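(* Let $\Gamma$ be a finite, simple, connected, regular graph on $n$ vertices with diameter $D$ and distinct adjacency eigenvalues $\lambda_0>\lambda_1>\cdots>\lambda_d$. Let $0\le h\le D$. Then $$\overline{\delta}_h\le\frac{p_h(\lambda_0)}{[\omega_h\,\overline{a}_h^{(h)}]^2},$$ with equality if and only if $\Gamma$ is $h$-punctually distance-regular, which is the case if and only if $\overline{a}_h^{(h)}=\gamma_1\gamma_2\cdots\gamma_h$ and $\overline{\delta}_h=p_h(\lambda_0)$.
   Context: $A$ is the adjacency matrix of $\Gamma$, $m_i$ the multiplicity of $\lambda_i$, $\partial(u,v)$ the distance. The distance-$h$ matrix $A_h$ has $(A_h)_{uv}=1$ if $\partial(u,v)=h$ and $0$ otherwise; $\overline{\delta}_h=\frac1n\sum_{u,v}(A_h)_{uv}$ is the average degree of the distance-$h$ graph. On the space $\mathbb{R}_d[x]$ of real polynomials of degree at most $d$ use the scalar product $\langle p,q\rangle=\frac1n\operatorname{tr}(p(A)q(A))=\frac1n\sum_{i=0}^d m_i p(\lambda_i)q(\lambda_i)$. The predistance polynomials $p_0,\dots,p_d$ are the unique polynomials with $\deg p_i=i$, $\langle p_i,p_j\rangle=0$ for $i\ne j$, and $\langle p_i,p_i\rangle=p_i(\lambda_0)$. For $0\le i\le d-1$ they satisfy a recurrence $xp_i=\beta_{i-1}p_{i-1}+\alpha_ip_i+\gamma_{i+1}p_{i+1}$ (with $\beta_{-1}=0$), which defines $\gamma_1,\dots,\gamma_d$. $\omega_h$ is the leading coefficient of $p_h$ (so $\omega_h=1/(\gamma_1\cdots\gamma_h)$;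 the empty product is $1$). $\overline{a}_h^{(\ell)}$ is the average of $(A^\ell)_{uv}$, the number of walks of length $\ell$ from $u$ to $v$, over all ordered pairs $(u,v)$ with $\partial(u,v)=h$. $\Gamma$ is $h$-punctually distance-regular if $A_h=q_h(A)$ for some polynomial $q_h\in\mathbb{R}_d[x]$ with $\deg q_h=h$. *)

(* Defs.v *)
From HB Require Import structures.
From mathcomp Require Import all_boot all_order all_algebra.

Set Implicit Arguments.
Unset Strict Implicit.
Unset Printing Implicit Defensive.

Import Order.TTheory GRing.Theory Num.Theory.
Local Open Scope ring_scope.

(* A simple graph is a symmetric irreflexive relation e on a finite type.     *)

Section Graphs.
Variables (V : finType) (e : rel V).

Definition connected_graph := forall u v : V, connect e u v.

Definition regular_graph :=
  exists k : nat, forall u : V, #|[set v | e u v]| = k.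

Definition has_walk (u v : V) (k : nat) : bool :=
  [exists p : k.-tuple V, path e u p && (last u p == v)].

(* The least k < #|V| for which there is a walk of length k from u to v; the  *)
(* value is #|V| when v cannot be reached from u.                             *)
Definition dist (u v : V) : nat := find (has_walk u v) (iota 0 #|V|).

Definition diameter : nat := (\max_(u : V) \max_(v : V) dist u v)%N.

End Graphs.

(* The vertices are 'I_n.+1, so the order of the graph is n.+1: horner_mx     *)
(* requires a nonzero size.                                                   *)

Section Matrices.
Variables (R : rcfType) (n : nat) (e : rel 'I_n.+1).

Definition adj_mx : 'M[R]_n.+1 := \matrix_(u, v) (e u v)%:R.

Definition dist_mx (h : nat) : 'M[R]_n.+1 := \matrix_(u, v) (dist e u v == h)%:R.

Definition avg_degree (h : nat) : R :=
  (\sum_u \sum_v dist_mx h u v) / n.+1%:R.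

Definition avg_walks (h l : nat) : R :=
  (\sum_u \sum_(v | dist e u v == h) (adj_mx ^+ l) u v)
    / #|[set uv : 'I_n.+1 * 'I_n.+1 | dist e uv.1 uv.2 == h]|%:R.

Definition distinct_eigenvalues (d : nat) (lam : 'I_d.+1 -> R) :=
  (forall i j : 'I_d.+1, (i < j)%N -> lam j < lam i) /\
  (forall x : R, eigenvalue adj_mx x <-> exists i, x = lam i).

Definition poly_dot (p q : {poly R}) : R :=
  \tr (horner_mx adj_mx p *m horner_mx adj_mx q) / n.+1%:R.

(* Only p 0, ..., p d are constrained, and these determine them uniquely.     *)
Definition predistance_polys (d : nat) (lam0 : R) (p : nat -> {poly R}) :=
  [/\ forall i, (i <= d)%N -> size (p i) = i.+1,
      forall i j, (i <= d)%N -> (j <= d)%N -> i <> j -> poly_dot (p i) (p j) = 0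
    & forall i, (i <= d)%N -> poly_dot (p i) (p i) = (p i).[lam0]].

(* beta (-1) = 0, hence the separate case i = 0.                              *)
Definition predistance_recurrence (d : nat) (p : nat -> {poly R})
    (alpha beta gamma : nat -> R) :=
  forall i, (i < d)%N ->
    'X * p i = (if i is j.+1 then beta j *: p j else 0)
               + alpha i *: p i + gamma i.+1 *: p i.+1.

Definition punctually_distance_regular (d h : nat) :=
  exists q : {poly R},
    [/\ (size q <= d.+1)%N, size q = h.+1 & dist_mx h = horner_mx adj_mx q].

End Matrices.

(* Main.v *)
(* Work with the Frobenius product <X, Y> = tr (X Y^T) / n. Since A^l vanishes on
   pairs at distance greater than l, A_h is orthogonal to every polynomial in A
   of degree less than h, so <A_h, p_h(A)> = omega_h <A_h, A^h>
   = omega_h a_h delta_h, while <A_h, A_h> = delta_h and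
   <p_h(A), p_h(A)> = p_h(lambda_0). Cauchy-Schwarz gives the bound, with
   equality iff A_h is a multiple of p_h(A). If A_h = q(A) with deg q = h, then
   subtracting the multiple of p_h with the leading coefficient of q leaves a
   polynomial r with r(A) orthogonal to itself, so A_h = c p_h(A); comparing row
   sums and norms gives delta_h = c p_h(lambda_0) = c^2 p_h(lambda_0), whence
   c = 1. *)
Require Import Defs.
From HB Require Import structures.
From mathcomp Require Import all_boot all_order all_algebra.
From mathcomp Require Import complex ring.

Set Implicit Arguments.
Unset Strict Implicit.
Unset Printing Implicit Defensive.

Import Order.TTheory GRing.Theory Num.Theory.
Local Open Scope ring_scope.

(* Complexifying a real symmetric matrix makes it diagonalizable, with spectrum
   still in R. *)
Lemma symmetric_horner_mx_eq0 (R : rcfType) (n : nat) (A : 'M[R]_n.+1)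
    (q : {poly R}) :
  A^T = A -> (forall x, eigenvalue A x -> root q x) -> horner_mx A q = 0.
Proof.
move=> A_sym q_root; pose f : {rmorphism R -> complex R} := real_complex R.
pose B := map_mx f A.
have B_real : B \is hermsymmx.
  apply: realsym_hermsym.
    by apply/is_hermitianmxP; rewrite scale1r map_mx_id // /B map_trmx A_sym.
  by apply/mxOverP => i j; rewrite mxE; apply/complex_realP; exists (A i j).
have /orthomx_spectralP B_eq := hermitian_normalmx B_real.
have P_unit := spectral_unit B.
move: B_eq P_unit (mxOverP (hermitian_spectral_diag_real B_real)).
set P := spectralmx B; set D := spectral_diag B => B_eq P_unit D_real.
have PB : P *m B = diag_mx D *m P by rewrite B_eq -!mulmxA mulKVmx.
apply: (@map_mx_inj _ _ f); rewrite map_mx0 map_horner_mx -/B B_eq.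
rewrite horner_mx_uconjC // horner_mx_diag.
set F := diag_mx _; suff -> : F = 0 by rewrite mulmx0 mul0mx.
apply/matrixP => i j; rewrite /F !mxE; case: (eqVneq i j) => [_|//].
rewrite mulr1n.
have /complex_realP[x Dx] := D_real 0 i.
(* Row [i] of [P] is a left eigenvector of [B] for the [i]-th diagonal entry, nonzero because [P] is
   invertible. *)
have Bx : eigenvalue B (f x).
  apply/eigenvalueP; exists (row i P).
    by rewrite -row_mul PB row_mul row_diag_mx -scalemxAl -rowE Dx.
  apply/eqP => Pi0; have := congr1 (mulmxr (invmx P)) Pi0.
  rewrite /= rowE mulmxK // mul0mx => /matrixP/(_ 0 i)/eqP.
  by rewrite !mxE !eqxx oner_eq0.
rewrite Dx horner_map; suff /rootP -> : root q x by rewrite rmorph0.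
apply: q_root; move: Bx; rewrite !eigenvalue_root_char /B -map_char_poly.
by rewrite fmorph_root.
Qed.

(** * Walks and shortest-walk distances *)

Section Walks.
Variables (V : finType) (e : rel V).
Implicit Types (u v w : V).

Lemma has_walkP u v k :
  reflect (exists p, [/\ path e u p, last u p = v & size p = k])
    (has_walk e u v k).
Proof.
apply: (iffP existsP) => [[p /andP[ep /eqP pv]]|[p [ep pv sp]]].
  by exists p; rewrite size_tuple.
have /eqP sp' := sp.
by exists (Tuple sp'); rewrite /= ep pv eqxx.
Qed.

Lemma has_walk_cat u v w k l :
  has_walk e u v k -> has_walk e v w l -> has_walk e u w (k + l).
Proof.
move=> /has_walkP[p [ep pv <-]] /has_walkP[q [eq qw <-]]; apply/has_walkP.
by exists (p ++ q); rewrite cat_path last_cat size_cat ep pv eq qw.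
Qed.

Lemma has_walkS u v k :
  has_walk e u v k.+1 = [exists w, e u w && has_walk e w v k].
Proof.
apply/has_walkP/existsP => [[[|w p] [//= /andP[uw wp] pv [sp]]]|[w]].
  by exists w; rewrite uw; apply/has_walkP; exists p.
by move=> /andP[uw /has_walkP[p [ep pv sp]]]; exists (w :: p); rewrite /= uw sp.
Qed.

Lemma dist_min u v k : has_walk e u v k -> (dist e u v <= k)%N.
Proof.
move=> uvk; rewrite leqNgt; apply/negP => k_lt.
have := before_find 0%N k_lt; rewrite nth_iota ?uvk //.
by apply: leq_trans k_lt _; rewrite -[X in (_ <= X)%N](size_iota 0) find_size.
Qed.

(** Shortening a path removes repeated vertices, so its length drops below [#|V|] and falls in the
    range searched by [dist]. *)
Lemma has_walk_dist u v : connect e u v -> has_walk e u v (dist e u v).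
Proof.
move=> /connectP[p ep ->]; case/shortenP: ep => q eq q_uniq _.
have q_lt : (size q < #|V|)%N.
  by have /card_uniqP/= <- := q_uniq; apply: max_card.
have walks : has (has_walk e u (last u q)) (iota 0 #|V|).
  by apply/hasP; exists (size q); [rewrite mem_iota | apply/has_walkP; exists q].
have := nth_find 0%N walks; rewrite nth_iota //.
by rewrite -[X in (_ < X)%N](size_iota 0) -has_find.
Qed.

(** The witness is the vertex at position [h] on a shortest path between two vertices at maximal
    distance: reaching it sooner would shorten that path. [u0] makes [V] nonempty, so that the
    maxima are attained. *)
Lemma exists_dist (u0 : V) h :
  connected_graph e -> (h <= diameter e)%N -> exists u v, dist e u v = h.
Proof.
move=> e_conn; rewrite /diameter.
have V_gt0 : (0 < #|V|)%N by apply/card_gt0P; exists u0.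
have [u ->] := bigop.eq_bigmax (fun u : V => \max_v dist e u v)%N V_gt0.
have [v ->] := bigop.eq_bigmax (fun v : V => dist e u v) V_gt0 => h_le.
have /has_walkP[p [ep pv sp]] := has_walk_dist (e_conn u v).
exists u, (last u (take h p)); move: ep pv.
rewrite -{1 2}(cat_take_drop h p) cat_path last_cat => /andP[ep1 ep2] pv.
apply/eqP; rewrite eqn_leq; apply/andP; split.
  apply: dist_min; apply/has_walkP; exists (take h p).
  by rewrite size_takel // sp.
have w1 := has_walk_dist (e_conn u (last u (take h p))).
have w2 : has_walk e (last u (take h p)) v (dist e u v - h).
  by apply/has_walkP; exists (drop h p); rewrite size_drop sp.
have := dist_min (has_walk_cat w1 w2).
by rewrite -(leq_add2r h) -addnA subnK // addnC leq_add2r.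
Qed.

End Walks.

(** * The Frobenius inner product *)

Section Frobenius.
Variables (R : realDomainType) (m : nat).
Implicit Types (X Y Z : 'M[R]_m).

Definition frob X Y := \tr (X *m Y^T).

Lemma frobE X Y : frob X Y = \sum_i \sum_j X i j * Y i j.
Proof.
by apply: eq_bigr => i _; rewrite mxE; apply: eq_bigr => j _; rewrite mxE.
Qed.

Lemma frobC X Y : frob X Y = frob Y X.
Proof. by rewrite /frob -mxtrace_tr trmx_mul trmxK. Qed.

Lemma frobBl X Y Z : frob (X - Y) Z = frob X Z - frob Y Z.
Proof. by rewrite /frob mulmxBl raddfB. Qed.

Lemma frobZl c X Y : frob (c *: X) Y = c * frob X Y.
Proof. by rewrite /frob -scalemxAl mxtraceZ. Qed.

(** When [c] is the projection coefficient, this squared norm measures the gap in Cauchy-Schwarz. *)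
Lemma frob_subZ c X Y :
  frob (X - c *: Y) (X - c *: Y)
    = frob X X - 2 * c * frob X Y + c ^+ 2 * frob Y Y.
Proof.
rewrite frobBl frobZl !(frobC _ (X - _)) !frobBl !frobZl (frobC Y X).
ring.
Qed.

Lemma frob_ge0 X : 0 <= frob X X.
Proof.
by rewrite frobE; do 2!apply: sumr_ge0 => ? _; rewrite -expr2 sqr_ge0.
Qed.

Lemma frob_eq0 X : (frob X X == 0) = (X == 0).
Proof.
apply/eqP/eqP => [|->]; last by rewrite /frob mul0mx raddf0.
have ge0 i j : 0 <= X i j * X i j by rewrite -expr2 sqr_ge0.
have ge0' i : 0 <= \sum_j X i j * X i j by apply: sumr_ge0.
rewrite frobE => /eqP; rewrite psumr_eq0 // => /allP X0.
apply/matrixP => i j; rewrite mxE.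
have /= := X0 i (mem_index_enum i); rewrite psumr_eq0 // => /allP.
by move=> /(_ j (mem_index_enum j)) /=; rewrite mulf_eq0 orbb => /eqP.
Qed.

End Frobenius.

(** * Polynomials in a matrix, and cancellation of top coefficients *)

Lemma trmx_horner_mx (R : comNzRingType) (m : nat) (A : 'M[R]_m.+1) (q : {poly R}) :
  A^T = A -> (horner_mx A q)^T = horner_mx A q.
Proof.
move=> A_sym; elim/poly_ind: q => [|q c IHq]; first by rewrite rmorph0 trmx0.
rewrite rmorphD rmorphM /= horner_mx_C horner_mx_X linearD /= tr_scalar_mx.
rewrite trmx_mul A_sym IHq; congr (_ + _).
exact: (comm_mx_horner q (erefl : comm_mx A A)).
Qed.

Lemma horner_mx_coef (R : comNzRingType) (m : nat) (A : 'M[R]_m.+1) (q : {poly R}) :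
  horner_mx A q = \sum_(i < size q) q`_i *: A ^+ i.
Proof.
rewrite -{1}[q]coefK poly_def raddf_sum; apply: eq_bigr => i _ /=.
by rewrite horner_mxZ rmorphXn /= horner_mx_X.
Qed.

(** One elimination step. Using the coefficient of index [i] instead of [lead_coef q] also covers
    [q] of degree below [i], where nothing is subtracted. *)
Lemma size_sub_lead (F : fieldType) (i : nat) (q r : {poly F}) :
  (size q <= i.+1)%N -> size r = i.+1 ->
  (size (q - (q`_i / lead_coef r) *: r)%R <= i)%N.
Proof.
move=> sq sr; apply/leq_sizeP => j; rewrite leq_eqVlt coefB coefZ.
have r_neq0 : lead_coef r != 0 by rewrite lead_coef_eq0 -size_poly_eq0 sr.
case/predU1P => [<-|ij]; last first.
  by rewrite (nth_default _ (leq_trans sq ij)) [r`_j]nth_default ?sr // mulr0 subr0.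
by move: r_neq0; rewrite lead_coefE sr => ri; rewrite divfK ?subrr.
Qed.

(** * Powers of the adjacency matrix and distances *)

Section Graph.
Variables (R : rcfType) (n : nat) (e : rel 'I_n.+1).
Local Notation A := (adj_mx R e).
Local Notation dot := (poly_dot e).

Lemma adj_mxX_ge0 k u v : 0 <= (A ^+ k) u v.
Proof.
elim: k u v => [|k IHk] u v; first by rewrite expr0 mxE.
rewrite exprS mxE; apply: sumr_ge0 => w _.
by rewrite mulr_ge0 // mxE.
Qed.

(** A sum of nonnegative terms is positive exactly when some term is; in [A * A ^+ k] such a term is
    a first step [w] of a walk. *)
Lemma adj_mxX_gt0 k u v : (0 < (A ^+ k) u v) = has_walk e u v k.
Proof.
elim: k u v => [|k IHk] u v.
  rewrite expr0 mxE; have -> : has_walk e u v 0 = (u == v).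
    apply/has_walkP/eqP => [[p [_ pv sp]]|->]; last by exists [::].
    by move: pv; rewrite (size0nil sp).
  by case: eqVneq => _; rewrite ?ltr01 ?ltxx.
rewrite has_walkS exprS mxE lt0r sumr_ge0 ?andbT => [|w _]; last first.
  by rewrite mulr_ge0 ?adj_mxX_ge0 // mxE.
rewrite psumr_neq0 => [|w _]; last by rewrite mulr_ge0 ?adj_mxX_ge0 // mxE.
apply/hasP/existsP => [[w _]|[w /andP[uw wv]]].
  rewrite /= mxE; case uw: (e u w); last by rewrite mul0r ltxx.
  by rewrite mul1r IHk => wv; exists w; rewrite uw.
by exists w; rewrite ?mem_index_enum //= mxE uw mul1r IHk.
Qed.

Lemma adj_mxX_lt_dist k u v : (k < dist e u v)%N -> (A ^+ k) u v = 0.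
Proof.
move=> k_lt; apply/eqP; rewrite -[_ == _]negbK; apply/negP => Akn0.
have : 0 < (A ^+ k) u v by rewrite lt0r Akn0 adj_mxX_ge0.
by rewrite adj_mxX_gt0 => /dist_min; rewrite leqNgt k_lt.
Qed.

(** Powers of [A] below [h] vanish at distance [h], so only the top power contributes. *)
Lemma horner_adj_mx_dist h (q : {poly R}) u v :
  (size q <= h.+1)%N -> dist e u v = h ->
  horner_mx A q u v = q`_h * (A ^+ h) u v.
Proof.
move=> sq uvh; rewrite horner_mx_coef.
rewrite (big_ord_widen _ (fun i => q`_i *: A ^+ i) sq) summxE.
rewrite big_mkcond big_ord_recr /= big1 ?add0r => [|i _].
  by case: ifPn => [_|]; rewrite ?mxE // -leqNgt => /(nth_default 0) ->;
     rewrite mul0r.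
by case: ifP; rewrite ?mxE // adj_mxX_lt_dist ?mulr0 // uvh.
Qed.

(* At distance d + 1, the annihilating polynomial of A with roots lambda_i would
   have the same (u, v) entry as A^(d+1), which is positive. As every distance up
   to the diameter D occurs, this yields D <= d. *)
Lemma dist_neq_num_eigenvalues d (lam : 'I_d.+1 -> R) u v :
  symmetric e -> connected_graph e -> distinct_eigenvalues e lam ->
  dist e u v <> d.+1.
Proof.
move=> e_sym e_conn [_ eig] uvd; pose q := \prod_(i < d.+1) ('X - (lam i)%:P).
have A_sym : A^T = A by apply/matrixP => i j; rewrite !mxE e_sym.
have sq : size q = d.+2.
  by rewrite size_prod_XsubC [index_enum _]unlock -enumT size_enum_ord.
have q0 : horner_mx A q = 0.
  apply: symmetric_horner_mx_eq0 => // x /eig[i ->].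
  by rewrite /root horner_prod (bigD1 i) //= hornerXsubC subrr mul0r.
have := @horner_adj_mx_dist d.+1 q u v.
rewrite q0 sq ltnSn mxE => /(_ isT uvd)/esym/eqP.
have -> : q`_d.+1 = 1.
  by have /monicP := monic_prod_XsubC (index_enum 'I_d.+1) predT lam;
     rewrite lead_coefE sq.
rewrite mul1r -uvd; apply/negP; rewrite gt_eqF // adj_mxX_gt0.
exact: has_walk_dist.
Qed.

(** * Averages expressed through Frobenius products *)

Lemma poly_dotE (q r : {poly R}) :
  symmetric e -> dot q r = frob (horner_mx A q) (horner_mx A r) / n.+1%:R.
Proof.
move=> e_sym; rewrite /frob trmx_horner_mx //.
by apply/matrixP => i j; rewrite !mxE e_sym.
Qed.

Lemma avg_degreeE h :
  avg_degree R e h = frob (dist_mx R e h) (dist_mx R e h) / n.+1%:R.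
Proof.
rewrite frobE; congr (_ / _); do 2!apply: eq_bigr => ? _.
by rewrite mxE -natrM mulnb andbb.
Qed.

Lemma avg_degree_card h :
  avg_degree R e h * n.+1%:R
    = #|[set uv : 'I_n.+1 * 'I_n.+1 | dist e uv.1 uv.2 == h]|%:R.
Proof.
rewrite mulfVK ?pnatr_eq0 // pair_bigA /= -sum1_card natr_sum.
rewrite [RHS]big_mkcond; apply: eq_bigr => uv _.
by rewrite mxE inE; case: eqP.
Qed.

Lemma avg_degree_gt0 h u v : dist e u v = h -> 0 < avg_degree R e h.
Proof.
move=> uvh; rewrite -(pmulr_lgt0 _ (ltr0Sn R n)) avg_degree_card ltr0n.
by apply/card_gt0P; exists (u, v); rewrite inE /= uvh.
Qed.

(** Allowing every degree up to [h] yields both the product with [p h] and, when the coefficient of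
    index [h] is zero, orthogonality to lower degrees. *)
Lemma frob_dist_mx_horner h (q : {poly R}) u v :
  (size q <= h.+1)%N -> dist e u v = h ->
  frob (dist_mx R e h) (horner_mx A q)
    = n.+1%:R * (q`_h * avg_walks R e h h * avg_degree R e h).
Proof.
move=> sq uvh.
have -> : frob (dist_mx R e h) (horner_mx A q)
    = q`_h * \sum_u \sum_(v | dist e u v == h) (A ^+ h) u v.
  rewrite frobE mulr_sumr; apply: eq_bigr => u' _.
  rewrite mulr_sumr [RHS]big_mkcond; apply: eq_bigr => v' _; rewrite mxE.
  by case: eqP => [uvh'|_]; rewrite ?mul0r // mul1r (horner_adj_mx_dist sq).
rewrite -[in RHS]mulrA [RHS]mulrCA; congr (_ * _).
rewrite mulrCA [n.+1%:R * _]mulrC avg_degree_card /avg_walks mulfVK //.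
by rewrite -avg_degree_card mulf_neq0 ?pnatr_eq0 // gt_eqF // (avg_degree_gt0 uvh).
Qed.

Lemma avg_walks_gt0 h u v :
  connected_graph e -> dist e u v = h -> 0 < avg_walks R e h h.
Proof.
move=> e_conn uvh.
rewrite /avg_walks -avg_degree_card divr_gt0 //; last first.
  by rewrite mulr_gt0 ?ltr0Sn // (avg_degree_gt0 uvh).
have ge0 u' : 0 <= \sum_(v | dist e u' v == h) (A ^+ h) u' v.
  by apply: sumr_ge0 => ? _; apply: adj_mxX_ge0.
rewrite (bigD1 u) //= ltr_pwDl ?sumr_ge0 // (bigD1 v) ?uvh //=.
rewrite ltr_pwDl ?sumr_ge0 // => [|? _]; last exact: adj_mxX_ge0.
by rewrite adj_mxX_gt0 -uvh has_walk_dist.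
Qed.

(** * Regularity: row sums and the largest eigenvalue *)

Lemma adj_mx_row_sum k u :
  (forall u, #|[set v | e u v]| = k) -> \sum_v A u v = k%:R.
Proof.
move=> /(_ u) <-; rewrite -sum1_card natr_sum [RHS]big_mkcond.
by apply: eq_bigr => v _; rewrite mxE inE; case: (e u v).
Qed.

(** Evaluate the eigenvector equation at an entry of largest absolute value: the [k] neighbours
    contribute at most [k] times that value. *)
Lemma adj_mx_eigenvalue_le k x :
  (forall u, #|[set v | e u v]| = k) -> symmetric e ->
  eigenvalue A x -> x <= k%:R.
Proof.
move=> e_reg e_sym /eigenvalueP[w wA w_neq0].
have [u _ u_max] := @arg_maxP _ R _ ord0 xpredT (fun v => `|w 0 v|) isT.
have wu_gt0 : 0 < `|w 0 u|.
  rewrite normr_gt0; apply: contraNneq w_neq0 => wu0.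
  apply/eqP/rowP => v; apply/eqP; rewrite mxE -normr_le0.
  by rewrite (le_trans (u_max v isT)) // wu0 normr0.
apply: le_trans (ler_norm x) _; rewrite -(ler_pM2r wu_gt0) -normrM.
have := congr1 (fun M : 'rV_n.+1 => M 0 u) wA; rewrite !mxE => <-.
apply: le_trans (ler_norm_sum _ _ _) _.
rewrite -(adj_mx_row_sum u e_reg) mulr_suml; apply: ler_sum => v _.
rewrite normrM mulrC !mxE e_sym normr_nat ler_wpM2l ?ler0n //.
exact: u_max.
Qed.

(** The all-ones vector shows that [k] is an eigenvalue, and no eigenvalue exceeds it. *)
Lemma max_eigenvalue_regular d (lam : 'I_d.+1 -> R) k :
  (forall u, #|[set v | e u v]| = k) -> symmetric e ->
  distinct_eigenvalues e lam -> lam ord0 = k%:R.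
Proof.
move=> e_reg e_sym [lam_dec lam_eig]; apply/eqP; rewrite eq_le.
rewrite (adj_mx_eigenvalue_le e_reg) //=; last by apply/lam_eig; exists ord0.
have /lam_eig[i ->] : eigenvalue A k%:R.
  apply/eigenvalueP; exists (const_mx 1).
    apply/rowP => v; rewrite !mxE mulr1 -(adj_mx_row_sum v e_reg).
    by apply: eq_bigr => u _; rewrite !mxE mul1r e_sym.
  by apply/eqP => /rowP/(_ 0)/eqP; rewrite !mxE oner_eq0.
have [->//|i_neq0] := eqVneq i ord0.
by apply/ltW/lam_dec; rewrite lt0n.
Qed.

Lemma horner_adj_mx_row_sum k (q : {poly R}) u :
  (forall u, #|[set v | e u v]| = k) ->
  \sum_v horner_mx A q u v = q.[k%:R].
Proof.
move=> e_reg; elim/poly_ind: q u => [|q c IHq] u.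
  by rewrite rmorph0 horner0 big1 // => v _; rewrite mxE.
rewrite rmorphD rmorphM /= horner_mx_C horner_mx_X.
under eq_bigr do rewrite !mxE.
rewrite big_split /= exchange_big /= hornerMXaddC; congr (_ + _).
  rewrite -(IHq u) mulr_suml; apply: eq_bigr => w _.
  by rewrite -mulr_sumr (adj_mx_row_sum w e_reg).
by rewrite (bigD1 u) //= eqxx big1 ?addr0 // => v; rewrite eq_sym => /negPf ->.
Qed.

Lemma avg_degree_horner k h (q : {poly R}) :
  (forall u, #|[set v | e u v]| = k) ->
  dist_mx R e h = horner_mx A q -> avg_degree R e h = q.[k%:R].
Proof.
move=> e_reg Aq; rewrite /avg_degree Aq.
under eq_bigr do rewrite (horner_adj_mx_row_sum _ _ e_reg).
by rewrite sumr_const card_ord -[_ *+ _]mulr_natr mulfK ?pnatr_eq0.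
Qed.

End Graph.

(** * Orthogonality and leading coefficients of the predistance polynomials *)

Section Predistance.
Variables (R : rcfType) (n : nat) (e : rel 'I_n.+1) (d : nat) (lam0 : R).
Variables (p : nat -> {poly R}).
Hypotheses (e_sym : symmetric e) (p_predist : predistance_polys e d lam0 p).
Local Notation A := (adj_mx R e).

(** Induction on [i]: subtracting a multiple of [p i], itself orthogonal to [p h], lowers the size
    bound on [q]. *)
Lemma frob_predistance_lt h i (q : {poly R}) :
  (h <= d)%N -> (i <= h)%N -> (size q <= i)%N ->
  frob (horner_mx A (p h)) (horner_mx A q) = 0.
Proof.
have [p_size p_orth _] := p_predist => h_le; elim: i q => [|i IHi] q ih sq.
  move: sq; rewrite leqn0 size_poly_eq0 => /eqP ->.
  by rewrite rmorph0 frobC /frob mul0mx raddf0.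
have i_le : (i <= d)%N by rewrite ltnW // (leq_trans ih).
have := IHi _ (ltnW ih) (size_sub_lead sq (p_size i i_le)).
rewrite rmorphB /= horner_mxZ frobC frobBl frobZl => /eqP; rewrite subr_eq0 => /eqP.
rewrite frobC => ->.
have hi : i <> h by move=> ih'; rewrite ih' ltnn in ih.
have := p_orth i h i_le h_le hi; rewrite poly_dotE // => /eqP.
by rewrite mulf_eq0 invr_eq0 pnatr_eq0 orbF => /eqP ->; rewrite mulr0.
Qed.

(** For a constant [c] the normalization reads [c * c = c], and the size condition excludes
    [c = 0]. *)
Lemma predistance0 : p 0 = 1.
Proof.
have [p_size _ p_norm] := p_predist.
have p0C := size1_polyC (eq_leq (p_size 0%N (leq0n d))).
have c_neq0 : (p 0)`_0 != 0.
  apply/eqP => c0; have := p_size 0%N (leq0n d).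
  by rewrite p0C c0 size_poly0.
have := p_norm 0%N (leq0n d).
rewrite p0C /poly_dot horner_mx_C -scalar_mxM mxtrace_scalar hornerC.
rewrite -[(_ * _) *+ _]mulr_natr mulfK ?pnatr_eq0 // -[RHS]mulr1.
by move=> /(mulfI c_neq0) ->.
Qed.

(** In degree [h.+1] of the recurrence only ['X * p h] and [p h.+1] contribute, so the leading
    coefficient of [p h] is [gamma h.+1] times that of [p h.+1]. *)
Lemma lead_coef_predistance (alpha beta gamma : nat -> R) h :
  predistance_recurrence d p alpha beta gamma -> (h <= d)%N ->
  lead_coef (p h) * \prod_(1 <= i < h.+1) gamma i = 1.
Proof.
move=> p_rec; have [p_size _ _] := p_predist.
elim: h => [|h IHh] h_lt.
  by rewrite predistance0 lead_coef1 big_geq ?mulr1.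
rewrite big_nat_recr //= mulrCA -[RHS](IHh (ltnW h_lt)) [RHS]mulrC.
congr (_ * _); rewrite !lead_coefE !p_size ?(ltnW h_lt) //=.
have := congr1 (fun q : {poly R} => q`_h.+1) (p_rec h h_lt).
rewrite coefXM /= !coefD !coefZ => ->.
rewrite [(p h)`_h.+1]nth_default ?p_size ?(ltnW h_lt) // mulr0 addr0 mulrC.
case: h h_lt {IHh} => [|h] h_lt; first by rewrite coef0 add0r.
have h_le : (h <= d)%N by apply: leq_trans (leqnSn h) (ltnW h_lt).
by rewrite coefZ [(p h)`_h.+2]nth_default ?mulr0 ?add0r ?p_size //.
Qed.

End Predistance.

(** * The inequality and the characterizations of equality *)

Theorem proposition4p2 (R : rcfType) (n : nat) (e : rel 'I_n.+1)
    (e_sym : symmetric e) (e_irr : irreflexive e)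
    (e_conn : connected_graph e) (e_reg : regular_graph e)
    (d : nat) (lam : 'I_d.+1 -> R)
    (lam_eig : distinct_eigenvalues e lam)
    (p : nat -> {poly R})
    (p_predist : predistance_polys e d (lam ord0) p)
    (alpha beta gamma : nat -> R)
    (p_rec : predistance_recurrence d p alpha beta gamma)
    (h : nat) (h_le : (h <= diameter e)%N) :
  let delta := avg_degree R e h in
  let a := avg_walks R e h h in
  let omega := lead_coef (p h) in
  let ph0 := (p h).[lam ord0] in
  [/\ delta <= ph0 / (omega * a) ^+ 2,
      delta = ph0 / (omega * a) ^+ 2 <-> punctually_distance_regular R e d h
    & punctually_distance_regular R e d h <->
      (a = \prod_(1 <= i < h.+1) gamma i /\ delta = ph0)].
Proof.
move=> delta a omega ph0; have [k e_reg'] := e_reg.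
have [u [v uvh]] := exists_dist ord0 e_conn h_le.
have h_le_d : (h <= d)%N.
  rewrite leqNgt; apply/negP => d_lt.
  have [u' [v' uv']] := exists_dist ord0 e_conn (leq_trans d_lt h_le).
  exact: (dist_neq_num_eigenvalues e_sym e_conn lam_eig uv').
have [p_size _ p_norm] := p_predist.
have lam0 : lam ord0 = k%:R := max_eigenvalue_regular e_reg' e_sym lam_eig.
have N_gt0 : 0 < n.+1%:R :> R by rewrite ltr0Sn.
have delta_gt0 : 0 < delta by apply: avg_degree_gt0 uvh.
have a_gt0 : 0 < a by apply: avg_walks_gt0 uvh.
have omega_neq0 : omega != 0.
  by rewrite lead_coef_eq0 -size_poly_eq0 p_size.
set N := n.+1%:R in N_gt0.
pose X := dist_mx R e h; pose Y := horner_mx (adj_mx R e) (p h).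
have XX : frob X X = N * delta.
  by rewrite /delta avg_degreeE mulrC mulfVK // gt_eqF.
have YY : frob Y Y = N * ph0.
  by rewrite /ph0 -p_norm // poly_dotE // mulrC mulfVK // gt_eqF.
have X_horner (q : {poly R}) : (size q <= h.+1)%N ->
    frob X (horner_mx (adj_mx R e) q) = N * (q`_h * a * delta).
  by move=> sq; apply: frob_dist_mx_horner sq uvh.
have delta_horner (q : {poly R}) :
    X = horner_mx (adj_mx R e) q -> delta = q.[lam ord0].
  by rewrite lam0; apply: avg_degree_horner.
clearbody delta a N.
have XY : frob X Y = N * (omega * a * delta).
  by rewrite X_horner ?p_size // /omega lead_coefE p_size.
(* A zero [Y] would make [frob X Y] vanish, yet every factor of [N * (omega * a * delta)] is
   nonzero. *)
have ph0_gt0 : 0 < ph0.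
  rewrite -(pmulr_rgt0 _ N_gt0) -YY lt0r frob_ge0 andbT frob_eq0.
  apply/eqP => Y0; move/eqP: XY; rewrite Y0 frobC /frob mul0mx raddf0 eq_sym.
  by rewrite !mulf_eq0 (negPf omega_neq0) !gt_eqF.
(* c *: Y is the orthogonal projection of X on the line of Y. *)
pose c := omega * a * delta / ph0.
have oa_gt0 : 0 < (omega * a) ^+ 2.
  by rewrite exprn_even_gt0 //= mulf_neq0 // gt_eqF.
(* [K] is the positive factor between the squared norm of [X - c *: Y] and the gap in the bound, so
   sign and vanishing transfer. *)
pose K := N * delta * (omega * a) ^+ 2 / ph0.
have K_gt0 : 0 < K by rewrite divr_gt0 // mulr_gt0 // mulr_gt0.
have XcY : frob (X - c *: Y) (X - c *: Y) = K * (ph0 / (omega * a) ^+ 2 - delta).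
  rewrite frob_subZ XX YY XY /c /K; field.
  by rewrite omega_neq0 !gt_eqF.
have eq_pdr : delta = ph0 / (omega * a) ^+ 2 -> punctually_distance_regular R e d h.
  move=> eq_delta; move/eqP: XcY; rewrite -eq_delta subrr mulr0 frob_eq0 subr_eq0.
  move=> /eqP XcY; exists (c *: p h); rewrite horner_mxZ size_scale ?p_size //.
  by rewrite /c !(mulf_eq0, invr_eq0) (negPf omega_neq0) !gt_eqF.
(* [omega * a = 1] serves both equivalences: it reduces the bound to [ph0], and comparison with
   [oprod] turns it into the product formula for [a]. *)
have pdr_eq : punctually_distance_regular R e d h -> omega * a = 1 /\ delta = ph0.
  move=> [q [_ q_size Xq]].
  pose c' := q`_h / omega; pose r := q - c' *: p h.
  have r_size : (size r <= h)%N.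
    by apply: size_sub_lead; rewrite ?q_size ?p_size.
  have rX : horner_mx (adj_mx R e) r = X - c' *: Y.
    by rewrite rmorphB /= horner_mxZ /X Xq.
  have X_eq : X = c' *: Y.
    (* As [r] has degree below [h], its value at the adjacency matrix is orthogonal to [X] and to
       [Y], hence to itself. *)
    apply/eqP; rewrite -subr_eq0 -rX -frob_eq0 {1}rX frobBl frobZl.
    rewrite (frob_predistance_lt e_sym p_predist h_le_d (leqnn h)) //.
    rewrite X_horner ?(leq_trans r_size) //.
    by rewrite (nth_default _ r_size) !mul0r !mulr0 subrr.
  have delta_c : delta = c' * ph0.
    rewrite /ph0 -hornerZ; apply: delta_horner.
    by rewrite horner_mxZ.
  have c1 : c' = 1.
    have c_neq0 : c' != 0.
      by apply: contraTneq delta_gt0 => c0; rewrite delta_c c0 mul0r ltxx.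
    move: XX; rewrite X_eq frobZl frobC frobZl YY delta_c => XX'.
    have Nc_neq0 := mulf_neq0 (lt0r_neq0 N_gt0) c_neq0.
    apply: (mulfI (mulf_neq0 Nc_neq0 (lt0r_neq0 ph0_gt0))).
    rewrite mulr1 -[RHS]mulrA -XX'; ring.
  (* Now [X = Y], so [XY] reads [N * ph0 = N * (omega * a * ph0)]. *)
  move: delta_c XY; rewrite X_eq c1 scale1r mul1r YY => ->.
  move=> /(mulfI (lt0r_neq0 N_gt0))/esym; rewrite -[RHS]mul1r.
  by move=> /(mulIf (lt0r_neq0 ph0_gt0)) ->.
have oprod := lead_coef_predistance p_predist p_rec h_le_d.
split.
- by rewrite -subr_ge0 -(pmulr_rge0 _ K_gt0) -XcY frob_ge0.
- by split=> // /pdr_eq[-> ->]; rewrite expr1n divr1.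
split=> [/pdr_eq[oa ->]|[a_prod eq_delta]].
  by split=> //; apply: (mulfI omega_neq0); rewrite oa oprod.
by apply: eq_pdr; rewrite eq_delta a_prod oprod expr1n divr1.
Qed.
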